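(* Let $n\ge2$. Given a configuration of $n+2$ oriented hyperbolic spheres $S_1,\ldots,S_{n+2}$ in hyperbolic $n$-space (hyperboloid model) which is an oriented hyperbolic Descartes configuration, the associated $(n+2)\times(n+2)$ matrix $\mathbf{W}_-$, whose $j$-th row is the vector $\mathbf{w}_-(S_j)$ of hyperbolic curvature-center coordinates of $S_j$, satisfies $$\mathbf{W}_-^T\mathbf{Q}_n\mathbf{W}_- = \begin{bmatrix}2&0&0\\0&-2&0\\0&0&2I_n\end{bmatrix} = \mathrm{diag}(2,-2,2,\ldots,2).$$
   Context: $\mathbf{Q}_n := I_{n+2} - \frac1n \mathbf{1}_{n+2}\mathbf{1}_{n+2}^T$, where $\mathbf{1}_{n+2}$ is the column vector of $n+2$ ones. The hyperboloid model of hyperbolic $n$-space is $H^n_+=\{(u_0,\ldots,u_n)\in\mathbb{R}^{n+1}: u_0^2=1+u_1^2+\cdots+u_n^2,\ u_0>0\}$, with hyperbolic distance given by $\cosh d(\mathbf{u},\mathbf{u}')=u_0u_0'-u_1u_1'-\cdots-u_nu_n'$. A hyperbolic sphere is the locus of points of $H^n_+$ at a fixed distance $\rho>0$ from a point $\mathbf{u}\in H^n_+$, its center. An oriented hyperbolic sphere has oriented hyperbolic radius $s=\rho$, with interior the set of points at distance less than $\rho$ from the center, or $s=-\rho$, with interior the set of points at distance greater than $\rho$ from the center; reversing the orientation replaces $s$ by $-s$. Two spheres are tangent if they meet in exactly one point. An oriented hyperbolic Descartes configuration is any set of $n+2$ mutually tangent oriented hyperbolic $(n-1)$-spheres having the property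 that either (i) all interiors of the spheres are disjoint, or (ii) the interiors of each pair of spheres intersect in a nonempty open set. For an oriented hyperbolic sphere $S$ with center $\mathbf{u}=(u_0,u_1,\ldots,u_n)$ and oriented hyperbolic radius $s$, its hyperbolic curvature-center coordinates are the row vector of length $n+2$ $$\mathbf{w}_-(S)=\Big(\coth s,\frac{u_0}{\sinh s},\frac{u_1}{\sinh s},\ldots,\frac{u_n}{\sinh s}\Big).$$
   Formalization: In condition (ii), the formal version also requires that neither interior of a pair contains the other; as worded the claim fails, e.g. for four mutually externally tangent circles in the hyperbolic plane, one with positive radius and three with negative radius. *)

(* Defs.v *)
From HB Require Import structures.
From mathcomp Require Import all_boot all_order all_algebra.
From mathcomp Require Import all_classical all_reals all_analysis.
From mathcomp Require Import ring lra.
Set Implicit Arguments.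
Unset Strict Implicit.
Unset Printing Implicit Defensive.
Import Order.TTheory GRing.Theory Num.Theory.
Import numFieldNormedType.Exports.
Local Open Scope classical_set_scope.
Local Open Scope ring_scope.

Section HyperbolicFunctions.
Variable R : realType.
Implicit Types x : R.

Definition cosh x : R := (expR x + expR (- x)) / 2.
Definition sinh x : R := (expR x - expR (- x)) / 2.
Definition coth x : R := cosh x / sinh x.

(* The inverse of cosh : [0, +oo[ -> [1, +oo[. *)
Definition arcosh x : R := ln (x + Num.sqrt (x ^+ 2 - 1)).

Lemma arcosh_ge0 x : 1 <= x -> 0 <= arcosh x.
Proof.
move=> x1; rewrite /arcosh ln_ge0//.
by have := sqrtr_ge0 (x ^+ 2 - 1); lra.
Qed.

Lemma arcoshK x : 1 <= x -> cosh (arcosh x) = x.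
Proof.
move=> x1; rewrite /cosh /arcosh expRN.
have s0 := sqrtr_ge0 (x ^+ 2 - 1).
have s2 : Num.sqrt (x ^+ 2 - 1) ^+ 2 = x ^+ 2 - 1.
  by rewrite sqr_sqrtr// subr_ge0 exprn_ege1.
set s := Num.sqrt _ in s0 s2 *.
have xs0 : 0 < x + s by lra.
rewrite lnK ?posrE//.
have -> : (x + s)^-1 = x - s.
  apply: (mulfI (lt0r_neq0 xs0)); rewrite mulfV ?gt_eqF//.
  by rewrite mulrC -subr_sqr s2; ring.
lra.
Qed.

End HyperbolicFunctions.

Section Hyperboloid.
Variables (R : realType) (n : nat).
Implicit Types u v x : 'rV[R]_n.+1.

(* u_0 is [u 0 0] and u_1, ..., u_n are the [u 0 (lift 0 i)], i : 'I_n. *)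
Definition hyperboloid : set 'rV[R]_n.+1 :=
  [set u | u 0 0 ^+ 2 = 1 + \sum_(i < n) u 0 (lift 0 i) ^+ 2 /\ 0 < u 0 0].

Definition lorentz u v : R :=
  u 0 0 * v 0 0 - \sum_(i < n) u 0 (lift 0 i) * v 0 (lift 0 i).

Definition hdist u v : R := arcosh (lorentz u v).

Lemma lorentz_ge1 u v : hyperboloid u -> hyperboloid v -> 1 <= lorentz u v.
Proof.
move=> [uE u0] [vE v0]; rewrite /lorentz.
set a := u 0 0 in uE u0 *; set b := v 0 0 in vE v0 *.
set A := \sum_(i < n) u _ _ ^+ 2 in uE; set B := \sum_(i < n) v _ _ ^+ 2 in vE.
set C := \sum_(i < n) _.
have sq (s t : R) : 0 <= s ^+ 2 * A - 2 * s * t * C + t ^+ 2 * B.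
  have -> : s ^+ 2 * A - 2 * s * t * C + t ^+ 2 * B =
      \sum_(i < n) (s * u 0 (lift 0 i) - t * v 0 (lift 0 i)) ^+ 2.
    rewrite !mulr_sumr -sumrB -big_split /=; apply: eq_bigr => i _; ring.
  by apply: sumr_ge0 => i _; exact: sqr_ge0.
have A0 : 0 <= A by have := sq 1 0; lra.
have CS : C ^+ 2 <= A * B.
  have := sq C A; rewrite [leRHS](_ : _ = A * (A * B - C ^+ 2)); last by ring.
  move: A0; rewrite le_eqVlt => /predU1P[A0|A0]; last first.
    by rewrite pmulr_rge0// subr_ge0.
  move=> _; have C0 : C = 0.
    apply/eqP/negPn/negP => C0.
    have := sq ((B + 1) / (2 * C)) 1; rewrite -A0.
    have -> : (2 * ((B + 1) / (2 * C)) * 1 * C) = B + 1 by field.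
    lra.
  by rewrite C0 -A0; lra.
have H : (1 + C) ^+ 2 <= (a * b) ^+ 2.
  by rewrite exprMn uE vE; have := sq 1 1; nra.
have ab0 : 0 < a * b by exact: mulr_gt0.
suff : 1 + C <= a * b by lra.
have [C0|C0] := leP (1 + C) 0; first by lra.
by rewrite -(ler_pXn2r (n := 2)) ?nnegrE// ltW.
Qed.

Lemma hdist_ge0 u v : hyperboloid u -> hyperboloid v -> 0 <= hdist u v.
Proof. by move=> Hu Hv; exact/arcosh_ge0/lorentz_ge1. Qed.

Lemma cosh_hdist u v : hyperboloid u -> hyperboloid v ->
  cosh (hdist u v) = lorentz u v.
Proof. by move=> Hu Hv; exact/arcoshK/lorentz_ge1. Qed.

(* Open in the subspace topology of the hyperboloid. *)
Definition hopen (A : set 'rV[R]_n.+1) : Prop :=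
  exists2 U : set 'rV[R]_n.+1, open U & A = hyperboloid `&` U.

End Hyperboloid.
Arguments hyperboloid : clear implicits.

Record osphere (R : realType) (n : nat) := OSphere {
  ocenter : 'rV[R]_n.+1 ;
  oradius : R ;
  ocenter_in : hyperboloid R n ocenter ;
  oradius_neq0 : oradius != 0
}.

Section OrientedSpheres.
Variables (R : realType) (n : nat).
Implicit Types S T : osphere R n.

Definition locus S : set 'rV[R]_n.+1 :=
  [set x | hyperboloid R n x /\ hdist (ocenter S) x = `|oradius S|].

Definition ointerior S : set 'rV[R]_n.+1 :=
  [set x | hyperboloid R n x /\
    if 0 < oradius S then hdist (ocenter S) x < `|oradius S|
    else `|oradius S| < hdist (ocenter S) x].

Definition tangent S T : Prop := exists p, locus S `&` locus T = [set p].

(* "The interiors intersect in a nonempty open set", where intersecting means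
   overlapping: neither interior is contained in the other.  Without this
   proviso, n + 2 nested balls tangent at one common point, or n + 2 mutually
   externally tangent spheres of which one has positive radius and the others
   have negative radius, would qualify as Descartes configurations.  For tangent spheres,
   overlapping amounts to having disjoint interiors once both orientations
   are reversed. *)
Definition overlapping S T : Prop :=
  [/\ ointerior S `&` ointerior T !=set0,
      hopen (ointerior S `&` ointerior T),
      ~ (ointerior S `<=` ointerior T) &
      ~ (ointerior T `<=` ointerior S)].

Definition descartes_configuration (S : 'I_n.+2 -> osphere R n) : Prop :=
  (forall i j, i != j -> tangent (S i) (S j)) /\
  ((forall i j, i != j -> ointerior (S i) `&` ointerior (S j) = set0) \/
   (forall i j, i != j -> overlapping (S i) (S j))).

(* The type is convertible to 'rV[R]_n.+2. *)
Definition curvature_center S : 'rV[R]_(1 + n.+1) :=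
  row_mx (coth (oradius S))%:M ((sinh (oradius S))^-1 *: ocenter S).

Definition W_mx (S : 'I_n.+2 -> osphere R n) : 'M[R]_n.+2 :=
  \matrix_(j < n.+2) (curvature_center (S j) : 'rV[R]_n.+2).

End OrientedSpheres.

Definition ones (R : realType) (m : nat) : 'cV[R]_m := const_mx 1.

Definition Q_mx (R : realType) (n : nat) : 'M[R]_n.+2 :=
  1%:M - n%:R^-1 *: (ones R n.+2 *m (ones R n.+2)^T).

(* Main.v *)
Require Import Defs.
From mathcomp Require Import all_boot all_order all_algebra.
From mathcomp Require Import all_classical all_reals all_analysis.
From mathcomp Require Import ring lra.
Import Order.TTheory GRing.Theory Num.Theory.
Local Open Scope classical_set_scope.
Local Open Scope ring_scope.

(** Put the form [a b - lorentz u v] of signature [(n + 1, 1)] on pairs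
    [(a, u)].  Each [w = w_-(S)] is a unit vector for it, and [S] and its
    interior are the loci in the hyperboloid where the product of [w] with the
    null vector [(1, x)] vanishes, resp. is positive.  If two spheres meet in a
    single point [p], then [p] is fixed by the reflection of the hyperboloid
    in the plane of the two centers, so the Gram determinant of [p] and the
    centers vanishes, i.e. the product of the two vectors [w] is [1] or [-1].
    If it were [1], the difference of these vectors would be null, hence would
    have a product of constant sign with all the [(1, x)]: one interior would
    contain the other.  So the product is [-1] for any two of the spheres,
    which determines the Gram matrix of the rows of [W_mx]; inverting it gives
    the theorem. *)

(** * Monotonicity of cosh and the sign of sinh *)

Section Hyperbolic.
Set Implicit Arguments.
Unset Strict Implicit.
Context {R : realType}.
Implicit Types x y : R.

Lemma coshN x : cosh (- x) = cosh x.
Proof. by rewrite /cosh opprK addrC. Qed.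

Lemma cosh_abs x : cosh `|x| = cosh x.
Proof. by case: ger0P => // _; rewrite coshN. Qed.

Lemma cosh2B_sinh2 x : cosh x ^+ 2 - sinh x ^+ 2 = 1.
Proof.
rewrite /cosh /sinh expRN; have := expR_gt0 x; set e := expR x => e0.
by field; lra.
Qed.

Lemma ltr_cosh x y : 0 <= x -> x < y -> cosh x < cosh y.
Proof.
move=> x0 xy; rewrite /cosh !expRN.
have a1 : 1 <= expR x by rewrite -expR0 ler_expR.
have ab : expR x < expR y by rewrite ltr_expR.
move: a1 ab; set a := expR x; set b := expR y => a1 ab.
(* The difference of the two values factors, and [a * b > 1] because [1 <= a < b]. *)
have -> : (b + b^-1) / 2 = (a + a^-1) / 2 + (b - a) * (a * b - 1) / (2 * a * b).
  by field; lra.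
rewrite ltrDl divr_gt0// ?mulr_gt0//; nra.
Qed.

Lemma ler_cosh x y : 0 <= x -> 0 <= y -> (cosh x <= cosh y) = (x <= y).
Proof.
move=> x0 y0; case: (ltgtP x y) => [xy|yx|->]; last exact: lexx.
- by rewrite ltW// ltr_cosh.
- by rewrite leNgt ltr_cosh.
Qed.

Lemma cosh_gt1 x : x != 0 -> 1 < cosh x.
Proof.
move=> x0; rewrite -cosh_abs.
have -> : 1 = cosh 0 :> R by rewrite /cosh oppr0 expR0; field.
by rewrite ltr_cosh// normr_gt0.
Qed.

Lemma sinh_gt0 x : 0 < x -> 0 < sinh x.
Proof.
move=> x0; rewrite /sinh divr_gt0// subr_gt0 ltr_expR; lra.
Qed.

Lemma sinh_lt0 x : x < 0 -> sinh x < 0.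
Proof.
move=> x0; rewrite /sinh pmulr_llt0 ?invr_gt0// subr_lt0 ltr_expR; lra.
Qed.

Lemma sinh_neq0 x : x != 0 -> sinh x != 0.
Proof.
by rewrite neq_lt => /orP[/sinh_lt0/ltr0_neq0|/sinh_gt0/lt0r_neq0].
Qed.

End Hyperbolic.

(** * The Lorentz form and the hyperboloid *)

Section Lorentz.
Set Implicit Arguments.
Unset Strict Implicit.
Context {R : realType} {n : nat}.
Implicit Types (u v w x p : 'rV[R]_n.+1) (a b : R).

Lemma lorentzC u v : lorentz u v = lorentz v u.
Proof.
by rewrite /lorentz mulrC; congr (_ - _); apply: eq_bigr => i _; rewrite mulrC.
Qed.

Lemma lorentz_lin a b u v w :
  lorentz (a *: u + b *: v) w = a * lorentz u w + b * lorentz v w.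
Proof.
rewrite /lorentz !mulrBr !mulr_sumr !mxE.
have -> : \sum_(i < n) (a *: u + b *: v) 0 (lift 0 i) * w 0 (lift 0 i) =
    \sum_(i < n) a * (u 0 (lift 0 i) * w 0 (lift 0 i)) +
    \sum_(i < n) b * (v 0 (lift 0 i) * w 0 (lift 0 i)).
  by rewrite -big_split /=; apply: eq_bigr => i _; rewrite !mxE; ring.
ring.
Qed.

Lemma lorentzv0 u : lorentz u 0 = 0.
Proof.
by rewrite lorentzC -(addr0 0) -{1}(scale0r u) -(scale0r u) lorentz_lin; ring.
Qed.

Lemma hyperboloid_lorentz u :
  hyperboloid R n u <-> lorentz u u = 1 /\ 0 < u 0 0.
Proof.
rewrite /hyperboloid /lorentz/= -expr2; under eq_bigr do rewrite expr2.
by split => -[h ?]; split => //; lra.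
Qed.

(** Otherwise [- v] lies on the hyperboloid, its coordinate 0 being nonzero since [lorentz v v > 0];
    then [lorentz (- v) u >= 1], against the sign hypothesis. *)
Lemma hyperboloid_unit u v : hyperboloid R n u ->
  lorentz v v = 1 -> 0 < lorentz v u -> hyperboloid R n v.
Proof.
move=> Hu vv vu; apply/hyperboloid_lorentz; split=> //.
rewrite ltNge; apply/negP => v0.
have v0E : v 0 0 != 0.
  apply/eqP => v00; move: vv; rewrite /lorentz v00 mul0r sub0r => h.
  suff : 0 <= \sum_(i < n) v 0 (lift 0 i) * v 0 (lift 0 i) by lra.
  by apply: sumr_ge0 => i _; rewrite -expr2 sqr_ge0.
have Nv w : lorentz (- v) w = - lorentz v w.
  have -> : - v = (-1) *: v + 0 *: v by rewrite scale0r addr0 scaleN1r.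
  by rewrite lorentz_lin; ring.
have HN : hyperboloid R n (- v).
  apply/hyperboloid_lorentz; rewrite Nv lorentzC Nv opprK; split => //.
  by rewrite mxE oppr_gt0 lt_neqAle v0E.
by have := lorentz_ge1 HN Hu; rewrite Nv; lra.
Qed.

(** Nonnegativity of the left side, for suitable [a] and [b], serves as the Cauchy-Schwarz
    inequality below. *)
Lemma sumsq_cross a b u v :
  \sum_(i < n) (a * u 0 (lift 0 i) - b * v 0 (lift 0 i)) ^+ 2 =
  a ^+ 2 * (u 0 0 ^+ 2 - lorentz u u) + b ^+ 2 * (v 0 0 ^+ 2 - lorentz v v)
  - 2 * a * b * (u 0 0 * v 0 0 - lorentz u v).
Proof.
rewrite /lorentz -!expr2 !opprB !addrA !(addrC _ (\sum_(_ < _) _)) !addrK.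
rewrite !mulr_sumr -big_split/= -sumrB; apply: eq_bigr => i _; ring.
Qed.

(** This is an equality case: with coefficients [v 0 0] and [u 0 0] the sum of squares equals
    [- (u 0 0 - v 0 0) ^+ 2], so every square vanishes. *)
Lemma lorentz_eq1 u v : hyperboloid R n u -> hyperboloid R n v ->
  lorentz u v = 1 -> u = v.
Proof.
move=> /hyperboloid_lorentz[uu u0] /hyperboloid_lorentz[vv v0] uv.
have := sumsq_cross (v 0 0) (u 0 0) u v; rewrite uu vv uv.
set s := \sum_(i < n) _ => sE.
have s0 : 0 <= s by apply: sumr_ge0 => i _; exact: sqr_ge0.
have uv0 : u 0 0 = v 0 0.
  apply/eqP; rewrite -subr_eq0 -sqrf_eq0; apply/eqP/le_anti.
  by rewrite sqr_ge0 andbT; lra.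
have /eqP : s = 0 by rewrite sE uv0; ring.
rewrite psumr_eq0; last by move=> i _; exact: sqr_ge0.
move=> /allP h; apply/rowP => i; case: (unliftP 0 i) => [j ->|->//].
have := h j (mem_index_enum j); rewrite sqrf_eq0 uv0 -mulrBr mulf_eq0.
by rewrite gt_eqF//= subr_eq0 => /eqP.
Qed.

(* [(1, x)] and [(a, u)] are null for [a b - lorentz u v]. *)
Lemma null_sign a u x : a ^+ 2 = lorentz u u -> hyperboloid R n x ->
  (0 <= u 0 0 -> a <= lorentz u x) /\ (u 0 0 <= 0 -> lorentz u x <= a).
Proof.
move=> au /hyperboloid_lorentz[xx x0].
have sq0 b c : 0 <= \sum_(i < n) (b * u 0 (lift 0 i) - c * x 0 (lift 0 i)) ^+ 2.
  by apply: sumr_ge0 => i _; exact: sqr_ge0.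
have := sq0 (x 0 0) (u 0 0); rewrite sumsq_cross xx -au => h1.
(* A null vector with [u 0 0 = 0] is zero, as [a ^+ 2] is then minus a sum of squares. *)
have [u00|u00] := eqVneq (u 0 0) 0.
  suff [-> ->] : a = 0 /\ lorentz u x = 0 by [].
  have := sq0 1 0; rewrite sumsq_cross u00 -au => h2.
  have a0 : a = 0.
    by apply/eqP; rewrite -sqrf_eq0; apply/eqP/le_anti; rewrite sqr_ge0 andbT; lra.
  split=> //; suff -> : u = 0 by rewrite lorentzC lorentzv0.
  have := sumsq_cross 1 0 u u; rewrite u00 -au a0.
  rewrite [RHS](_ : _ = 0); last by ring.
  move=> /eqP; rewrite psumr_eq0; last by move=> i _; exact: sqr_ge0.
  move=> /allP h; apply/rowP => i; case: (unliftP 0 i) => [j ->|->//].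
    have := h j (mem_index_enum j).
    by rewrite sqrf_eq0 mul1r mul0r subr0 mxE => /eqP.
  by rewrite u00 mxE.
(* [h1] bounds [2 * u 0 0 * x 0 0 * lorentz u x] below by [u 0 0 ^+ 2 + x 0 0 ^+ 2 * a ^+ 2], which
   is at least [2 * u 0 0 * x 0 0 * a]. *)
have h : 0 <= u 0 0 * x 0 0 * (lorentz u x - a).
  have := sqr_ge0 (u 0 0 - x 0 0 * a); nra.
split=> u0.
- have {}u0 : 0 < u 0 0 by rewrite lt_neqAle eq_sym u00.
  by move: h; rewrite pmulr_rge0 ?mulr_gt0// subr_ge0.
- have {}u0 : u 0 0 < 0 by rewrite lt_neqAle u00.
  by move: h; rewrite nmulr_rge0 ?nmulr_rlt0// ?subr_le0// nmulr_rlt0.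
Qed.

(* The point [q] below is the reflection of [p] in the span of [u] and [v]. *)
Lemma reflection_gram u v p :
  hyperboloid R n u -> hyperboloid R n v -> hyperboloid R n p ->
  (forall q, hyperboloid R n q -> lorentz u q = lorentz u p ->
     lorentz v q = lorentz v p -> q = p) ->
  (lorentz u p * lorentz v p - lorentz u v) ^+ 2 =
  (lorentz u p ^+ 2 - 1) * (lorentz v p ^+ 2 - 1).
Proof.
move=> Hu Hv Hp pP; have uv1 := lorentz_ge1 Hu Hv.
have [uv|uvN] := eqVneq (lorentz u v) 1.
  by rewrite uv (lorentz_eq1 Hu Hv uv); ring.
have up1 := lorentz_ge1 Hu Hp.
have [[uu _] [vv _]] := ((hyperboloid_lorentz u).1 Hu, (hyperboloid_lorentz v).1 Hv).
have [pp _] := (hyperboloid_lorentz p).1 Hp.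
set x := lorentz u v in uv1 uvN *; set y := lorentz u p in pP up1 *.
set z := lorentz v p in pP *.
have x1 : 1 - x ^+ 2 != 0 by rewrite lt_eqF//; nra.
(* These coefficients make [a] the orthogonal projection of [p] on the span of [u] and [v], whose
   Gram determinant is [1 - x ^+ 2]. *)
pose al := (y - x * z) / (1 - x ^+ 2); pose be := (z - x * y) / (1 - x ^+ 2).
pose a := al *: u + be *: v; pose q := 2 *: a + (-1) *: p.
have aE w : lorentz a w = al * lorentz u w + be * lorentz v w by exact: lorentz_lin.
have qE w : lorentz q w = 2 * lorentz a w - lorentz p w.
  by rewrite lorentz_lin mulN1r.
have au : lorentz a u = y.
  by rewrite aE uu (lorentzC v u) -/x /al /be; field.
have av : lorentz a v = z.
  by rewrite aE vv -/x /al /be; field.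
have ap : lorentz a p = al * y + be * z by rewrite aE.
have aa : lorentz a a = al * y + be * z.
  by rewrite {1}aE lorentzC au (lorentzC v) av.
have qu : lorentz q u = y by rewrite qE au (lorentzC p) -/y; ring.
have qv : lorentz q v = z by rewrite qE av (lorentzC p) -/z; ring.
have qq : lorentz q q = 1.
  rewrite qE (lorentzC a) (lorentzC p) !qE aa (lorentzC p a) ap pp; ring.
have Hq : hyperboloid R n q by apply: (hyperboloid_unit Hu qq); rewrite qu; lra.
have qp : q = p by apply: pP => //; rewrite lorentzC.
have : lorentz q p = 1 by rewrite qp.
rewrite qE ap pp => h.
(* The projection of [p] has the same norm as [p]; clearing the denominator yields the vanishing
   Gram determinant of [u], [v], [p]. *)
have : al * y + be * z = 1 by lra.
have -> : al * y + be * z = (y ^+ 2 + z ^+ 2 - 2 * x * y * z) / (1 - x ^+ 2).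
  by rewrite /al /be; field.
move=> /(congr1 ( *%R^~ (1 - x ^+ 2))); rewrite divfK// mul1r => e.
nra.
Qed.

(* Fails for [n = 0], where the hyperboloid is a point. *)
Lemma lorentz_unbounded u a : (0 < n)%N -> hyperboloid R n u ->
  exists2 x, hyperboloid R n x & a < lorentz u x.
Proof.
move=> n0 Hu; have [uE u0] := Hu; pose k := Ordinal n0.
have u1 : 1 <= u 0 0.
  rewrite -(ler_pXn2r (n := 2)) ?nnegrE ?(ltW u0)// expr1n uE lerDl.
  by apply: sumr_ge0 => i _; exact: sqr_ge0.
(* The sign of [t] makes the spatial term of [lorentz u x] help, so that
   [lorentz u x >= s * u 0 0 >= s > a]. *)
have [t [at_ tu]] : exists t, `|a| <= `|t| /\ t * u 0 (lift 0 k) <= 0.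
  have [h|h] := leP 0 (u 0 (lift 0 k)).
    by exists (- `|a|); rewrite normrN normr_id mulNr oppr_le0 mulr_ge0.
  by exists `|a|; rewrite normr_id; split => //; rewrite mulr_ge0_le0// ltW.
pose s := Num.sqrt (1 + t ^+ 2).
have s2 : s ^+ 2 = 1 + t ^+ 2 by rewrite sqr_sqrtr// addr_ge0// sqr_ge0.
have ts : `|t| < s.
  rewrite -(ltr_pXn2r (n := 2)) ?nnegrE ?sqrtr_ge0// s2 real_normK ?num_real//.
  by rewrite ltrDr.
have s0 : 0 < s by exact: le_lt_trans (normr_ge0 t) ts.
pose x : 'rV[R]_n.+1 := \row_i (if i == 0 then s else if i == lift 0 k then t else 0).
have x0E : x 0 0 = s by rewrite mxE.
have xE i : x 0 (lift 0 i) = if i == k then t else 0.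
  by rewrite mxE (inj_eq (@lift_inj _ _)).
exists x.
  split; last by rewrite x0E.
  rewrite x0E (bigD1 k)//= big1 ?addr0; last first.
    by move=> i ik; rewrite xE (negbTE ik) expr0n.
  by rewrite xE eqxx.
rewrite /lorentz x0E (bigD1 k)//= big1 ?addr0; last first.
  by move=> i ik; rewrite xE (negbTE ik) mulr0.
rewrite xE eqxx; have := ler_norm a; nra.
Qed.

End Lorentz.

(** * Spheres as unit vectors, tangency and nesting *)

Section Spheres.
Set Implicit Arguments.
Unset Strict Implicit.
Context {R : realType} {n : nat}.
Implicit Types (S T : osphere R n) (x : 'rV[R]_n.+1).

Local Notation inc S := (ocenter_in S).
Local Notation ch S := (cosh (oradius S)).
Local Notation sh S := (sinh (oradius S)).

(* The products of [w_-(S)] with [(1, x)] and with [w_-(T)]. *)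
Definition sphere_val S x : R := coth (oradius S) - lorentz (ocenter S) x / sh S.

Definition sphere_prod S T : R :=
  coth (oradius S) * coth (oradius T) -
  lorentz (ocenter S) (ocenter T) / (sh S * sh T).

Lemma sh_neq0 S : sh S != 0.
Proof. exact/sinh_neq0/oradius_neq0. Qed.

Lemma sphere_prodxx S : sphere_prod S S = 1.
Proof.
have [uu _] := (hyperboloid_lorentz _).1 (inc S).
rewrite /sphere_prod /coth uu; have := cosh2B_sinh2 (oradius S).
have := sh_neq0 S; set s := sinh _; set c := cosh _ => s0 h.
have -> : c / s * (c / s) - 1 / (s * s) = (c ^+ 2 - 1) / s ^+ 2 by field.
have -> : c ^+ 2 - 1 = s ^+ 2 by lra.
by rewrite divff// sqrf_eq0.
Qed.

Lemma locusE S x :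
  locus S x <-> hyperboloid R n x /\ lorentz (ocenter S) x = ch S.
Proof.
split=> -[Hx h]; split=> //.
  by rewrite -(cosh_hdist (inc S) Hx) h cosh_abs.
have : cosh (hdist (ocenter S) x) = cosh `|oradius S|.
  by rewrite (cosh_hdist (inc S) Hx) cosh_abs.
have d0 := hdist_ge0 (inc S) Hx.
by move=> e; apply/le_anti; rewrite -(ler_cosh d0)// -(ler_cosh _ d0)// e lexx.
Qed.

(** [sphere_val S x] is [cosh s - lorentz (ocenter S) x] divided by [sinh s]; the sign of [sinh s]
    carries the orientation. *)
Lemma ointeriorE S x :
  ointerior S x <-> hyperboloid R n x /\ 0 < sphere_val S x.
Proof.
suff h : hyperboloid R n x -> (0 < sphere_val S x) =
    (if 0 < oradius S then hdist (ocenter S) x < `|oradius S|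
     else `|oradius S| < hdist (ocenter S) x).
  by split=> -[Hx]; split=> //; [rewrite h|rewrite -h].
move=> Hx; have d0 := hdist_ge0 (inc S) Hx.
rewrite !ltNge -(ler_cosh d0)// -(ler_cosh _ d0)// cosh_abs.
rewrite (cosh_hdist (inc S) Hx) -!ltNge /sphere_val /coth -mulrBl.
have := oradius_neq0 S; rewrite neq_lt => /orP[s0|s0].
  by rewrite [0 < oradius S]ltNge ltW//= nmulr_lgt0 ?invr_lt0 ?sinh_lt0// subr_lt0.
by rewrite s0 pmulr_lgt0 ?invr_gt0 ?sinh_gt0// subr_gt0.
Qed.

Lemma ointerior_neq0 S : (0 < n)%N -> ointerior S !=set0.
Proof.
move=> n0; have := oradius_neq0 S; rewrite neq_lt => /orP[s0|s0].
  have [x Hx h] := lorentz_unbounded (ch S) n0 (inc S).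
  exists x; apply/ointeriorE; split=> //.
  by rewrite /sphere_val /coth -mulrBl nmulr_lgt0 ?invr_lt0 ?sinh_lt0// subr_lt0.
exists (ocenter S); apply/ointeriorE; split; first exact: ocenter_in.
have [uu _] := (hyperboloid_lorentz _).1 (inc S).
rewrite /sphere_val uu /coth -mulrBl pmulr_lgt0 ?invr_gt0 ?sinh_gt0// subr_gt0.
exact/cosh_gt1/oradius_neq0.
Qed.

(** The common points of the loci are those with prescribed Lorentz products with both centers, so a
    unique one meets the hypothesis of [reflection_gram]. *)
Lemma tangent_prod S T : tangent S T -> sphere_prod S T ^+ 2 = 1.
Proof.
move=> [p pE].
have [/locusE[Hp Sp] /locusE[_ Tp]] : (locus S `&` locus T) p by rewrite pE.
have h : (ch S * ch T - lorentz (ocenter S) (ocenter T)) ^+ 2 =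
    (ch S ^+ 2 - 1) * (ch T ^+ 2 - 1).
  rewrite -Sp -Tp; apply: reflection_gram (inc S) (inc T) Hp _ => q Hq.
  rewrite Sp Tp => Sq Tq.
  suff : (locus S `&` locus T) q by rewrite pE.
  by split; apply/locusE.
have s0 := sh_neq0 S; have t0 := sh_neq0 T.
have -> : sphere_prod S T ^+ 2 =
    (ch S * ch T - lorentz (ocenter S) (ocenter T)) ^+ 2 / (sh S ^+ 2 * sh T ^+ 2).
  by rewrite /sphere_prod /coth; field; rewrite t0 s0.
rewrite h; have -> : ch S ^+ 2 - 1 = sh S ^+ 2.
  by have := cosh2B_sinh2 (oradius S); lra.
have -> : ch T ^+ 2 - 1 = sh T ^+ 2 by have := cosh2B_sinh2 (oradius T); lra.
by rewrite divff// mulf_neq0// sqrf_eq0.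
Qed.

Lemma prod1_nested S T : sphere_prod S T = 1 ->
  ointerior S `<=` ointerior T \/ ointerior T `<=` ointerior S.
Proof.
(* The pair [(a, u)] is the difference of the two unit vectors, of norm [1 - 2 + 1 = 0]; the sign of
   [u 0 0] decides which interior is the smaller. *)
move=> ST; pose a := coth (oradius S) - coth (oradius T).
pose u := (sh S)^-1 *: ocenter S + (- (sh T)^-1) *: ocenter T.
have uE x : lorentz u x =
    lorentz (ocenter S) x / sh S - lorentz (ocenter T) x / sh T.
  by rewrite lorentz_lin; ring.
have au : a ^+ 2 = lorentz u u.
  have := sphere_prodxx S; have := sphere_prodxx T; move: ST.
  rewrite uE (lorentzC _ u) (lorentzC _ u) !uE (lorentzC (ocenter T) (ocenter S)).
  rewrite /sphere_prod /a !invfM; nra.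
have fE x : sphere_val S x - sphere_val T x = a - lorentz u x.
  by rewrite uE /sphere_val /a; ring.
have [u0|u0] := leP 0 (u 0 0); [left|right] => x /ointeriorE[Hx fx];
  apply/ointeriorE; split=> //.
- have := (null_sign au Hx).1 u0; have := fE x; lra.
- have := (null_sign au Hx).2 (ltW u0); have := fE x; lra.
Qed.

(** Nesting contradicts [overlapping] directly, and disjointness because interiors are nonempty. *)
Lemma descartes_prod (S : 'I_n.+2 -> osphere R n) i j : (0 < n)%N ->
  descartes_configuration S -> i != j -> sphere_prod (S i) (S j) = -1.
Proof.
move=> n0 [tS dS] ij.
have /eqP := tangent_prod (tS i j ij); rewrite sqrf_eq1 => /orP[/eqP|/eqP//].
move=> /prod1_nested h; exfalso.
have [dS'|dS'] := dS; last first.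
  by have [_ _ ? ?] := dS' i j ij; case: h.
have disj x : ointerior (S i) x -> ointerior (S j) x -> False.
  by move=> xi xj; have : (ointerior (S i) `&` ointerior (S j)) x by []; rewrite dS'.
by case: h => h; [have [x xi] := ointerior_neq0 (S i) n0
  | have [x xi] := ointerior_neq0 (S j) n0]; apply: (disj x) => //; exact: h.
Qed.

(** The form is diagonal in these coordinates; its only -1 is at index 1, the column of
    [u_0 / sinh s]. *)
Lemma W_mx_gram (S : 'I_n.+2 -> osphere R n) i j :
  (W_mx S *m diag_mx (\row_k (if k == 1%N :> nat then -1 else 1)) *m (W_mx S)^T) i j
  = sphere_prod (S i) (S j).
Proof.
have W0 l : W_mx S l 0 = coth (oradius (S l)).
  have -> : (0 : 'I_n.+2) = lshift n.+1 (0 : 'I_1) by exact: val_inj.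
  by rewrite mxE; apply: etrans (row_mxEl _ _ _ _) _; rewrite mxE mulr1n.
have W1 l (k : 'I_n.+1) :
    W_mx S l (lift 0 k) = (sh (S l))^-1 * ocenter (S l) 0 k.
  have -> : (lift 0 k : 'I_n.+2) = rshift 1 k by exact: val_inj.
  by rewrite mxE; apply: etrans (row_mxEr _ _ _ _) _; rewrite mxE.
rewrite mul_mx_diag mxE.
under eq_bigr => k _ do
  rewrite [X in X * _]mxE [X in _ * X * _]mxE [X in _ * X]mxE.
rewrite 2!big_ord_recl !W0 !W1 /= mulr1 mulrN1.
under eq_bigr => k _ do rewrite !W1 /= mulr1.
rewrite /sphere_prod /lorentz [(sh (S i) * _)^-1]invfM mulrBl opprB mulr_suml.
rewrite [X in _ = _ + (X - _)](eq_bigr (fun k : 'I_n =>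
    (sh (S i))^-1 * ocenter (S i) 0 (lift 0 k) *
    ((sh (S j))^-1 * ocenter (S j) 0 (lift 0 k)))).
  by ring.
by move=> k _; ring.
Qed.

End Spheres.

(** * Inversion of the Gram matrix *)

Theorem theorem6p2 (R : realType) (n : nat) (hn : (2 <= n)%N)
    (S : 'I_n.+2 -> osphere R n) (hS : descartes_configuration S) :
  (W_mx S)^T *m Q_mx R n *m W_mx S =
    diag_mx (\row_(k < n.+2) (if k == 1%N :> nat then - 2 else 2 : R)).
Proof.
have n0 : (0 < n)%N by exact: ltnW.
have nR : n%:R != 0 :> R by rewrite pnatr_eq0 -lt0n.
set W := W_mx S; set D := diag_mx _.
pose E : 'M[R]_n.+2 := diag_mx (\row_k (if k == 1%N :> nat then -1 else 1)).
pose J : 'M[R]_n.+2 := ones R n.+2 *m (ones R n.+2)^T.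
have JE i j : J i j = 1 by rewrite mxE big_ord1 !mxE mulr1.
have JJ : J *m J = n.+2%:R *: J.
  apply/matrixP => i j; rewrite mxE [RHS]mxE JE mulr1.
  by under eq_bigr do rewrite !JE mulr1; rewrite sumr_const card_ord.
have gram : W *m E *m W^T = 2 *: 1%:M - J.
  apply/matrixP => i j; rewrite W_mx_gram mxE [(- J) i j]mxE JE !mxE.
  have [->|ij] := eqVneq i j; first by rewrite sphere_prodxx/=; ring.
  by rewrite descartes_prod//=; ring.
(* The coefficient of [J] in the product is [- 1 - 2 / n + (n + 2) / n = 0]. *)
have gramQ : W *m E *m W^T *m Q_mx R n = 2 *: 1%:M.
  rewrite gram /Q_mx -/J mulmxBl mulmxBr mulmx1 -scalemxAl mul1mx.
  rewrite mulmxBr mulmx1 -scalemxAr JJ !scalerA.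
  apply/matrixP => i j; have := JE i j; rewrite !mxE => ->.
  have -> : n.+2%:R = n%:R + 2 :> R by rewrite -natrD addn2.
  by field.
have DE : D *m E = 2 *: 1%:M.
  rewrite mulmx_diag; apply/matrixP => i j; rewrite !mxE.
  by case: ifP => _; case: eqP => _ /=; ring.
(* A right inverse of the square matrix [W] is also a left inverse; multiplying by [D], which is
   [2 *: E], then cancels [E]. *)
have : W *m (2^-1 *: E *m W^T *m Q_mx R n) = 1%:M.
  by rewrite -!scalemxAl -scalemxAr !mulmxA gramQ scalerA mulVf// scale1r.
move=> /mulmx1C /(congr1 (mulmx D)); rewrite mulmx1 !mulmxA -scalemxAr DE.
by rewrite scalerA mulVf// scale1r mul1mx.
Qed.
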